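(* If an $n$-vertex graph $G$ is not 2-paintable, then $n\le M(G)\le 2n-3$.
   Context: All graphs are finite and simple. Let $f:V(G)\to\mathbb{Z}_{\ge 0}$. The game $(G,f)$ is played by Lister and Painter. In round $i$ Lister chooses, adaptively, a nonempty set $V_i\subseteq V(G)$ of marked vertices, and then Painter, seeing $V_1,\dots,V_i$, chooses an independent set $X_i\subseteq V_i$ whose vertices receive color $i$. A vertex that has been colored needs no further coloring, but may still be marked later. Painter wins if at the end every vertex has been colored. In the game with exactly $t$ rounds ($t$ is known to both players in advance), Lister must choose $V_1,\dots,V_t$ so that each vertex $v$ lies in exactly $f(v)$ of them; $G$ is $[f,t]$-paintable if Painter has a winning strategy in this game (vacuously true if no legal sequence of marked sets of length $t$ exists). In the unrestricted game the number of rounds is not fixed in advance and play continues until every vertex $v$ has been marked $f(v)$ times (never more); $G$ is $f$-paintable if Painter has a winning strategy in the unrestricted game. For the constant function $f\equiv k$ we say $k$-paintable and $[k,t]$-paintable. $M(G)$ is the maximum $t$ such that $G$ is not $[2,t]$-paintable. *)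

(* Defs.v *)
From mathcomp Require Import all_boot.

Set Implicit Arguments.
Unset Strict Implicit.
Unset Printing Implicit Defensive.

(* A finite simple graph is a symmetric irreflexive relation e on a finType. *)

Definition independent (T : finType) (e : rel T) (X : {set T}) : bool :=
  [forall u in X, forall v in X, ~~ e u v].

(* The complete sequences of marked sets available to Lister: every set is
   nonempty and every vertex v is marked exactly f v times. *)
Definition legal_play (T : finType) (f : T -> nat) (Vs : seq {set T}) : Prop :=
  all (fun V => V != set0) Vs /\
  forall v : T, count (fun V : {set T} => v \in V) Vs = f v.

(* Painter's reply as a function of the history V_1, ..., V_i, where V_i is the
   set that has just been marked. *)
Definition strategy (T : finType) : Type := seq {set T} -> {set T}.

(* Rounds are numbered from 0: the reply in round i depends only on the first
   i.+1 marked sets. *)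
Definition reply (T : finType) (S : strategy T) (Vs : seq {set T}) (i : nat) :
    {set T} :=
  S (take i.+1 Vs).

Definition wins_play (T : finType) (e : rel T) (S : strategy T)
    (Vs : seq {set T}) : Prop :=
  (forall i, i < size Vs ->
     reply S Vs i \subset nth set0 Vs i /\ independent e (reply S Vs i)) /\
  (forall v : T, exists2 i, i < size Vs & v \in reply S Vs i).

(* A strategy is fixed before Vs is quantified, so ranging over all sequences
   Vs accounts for an adaptive Lister. *)
Definition paintable (T : finType) (e : rel T) (f : T -> nat) : Prop :=
  exists S : strategy T, forall Vs, legal_play f Vs -> wins_play e S Vs.

(* [f, t]-paintability; here the strategy may depend on t. *)
Definition paintable_in (T : finType) (e : rel T) (f : T -> nat) (t : nat) :
    Prop :=
  exists S : strategy T,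
    forall Vs, legal_play f Vs -> size Vs = t -> wins_play e S Vs.

(* m = M(G): the maximum t such that the graph is not [2, t]-paintable. *)
Definition is_M (T : finType) (e : rel T) (m : nat) : Prop :=
  ~ paintable_in e (fun _ => 2) m /\
  forall t, ~ paintable_in e (fun _ => 2) t -> t <= m.

(* Main.v *)
Require Import Defs.
From mathcomp Require Import all_boot.
From mathcomp Require Import boolp zify.

(** Throughout, a position of the game is a pair (U, f): U is the set of
    uncolored vertices and f v is the number of marks that v has still to
    receive.  A sequence of t marked sets using up f has excess
    sum f - t, the sum of |V_i| - 1 over its rounds; with n vertices marked
    twice, t rounds means excess 2n - t.

    Upper bound.  If t >= 2n - 2 the excess is at most 2, and Painter wins by
    coloring in each round one vertex, preferably one that is about to receive
    its last mark: the number of uncolored vertices with a single mark left,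
    plus the excess still to come, never exceeds 2, and that leaves no room for
    a marked set with two vertices at their last mark ([greedy_wins]).

    Lower bound.  Lister wins some fixed number of rounds t >= n; t = n works.
    Since the unrestricted game is finite, it is determined: Lister has a
    winning strategy ([determinacy]).  It remains to make this strategy cheap
    and to make its length exactly n ([lister_wins_timely]).

    Cheap: a move of the strategy marks A, vertices with two marks left, and B,
    vertices with one mark left.  If B spans an edge, marking its two ends
    together wins at excess 1.  Otherwise B is independent and Painter has to
    color all of it, so Lister may treat the elements b of B one at a time,
    marking b with those neighbors of b in A that have not been marked yet:
    Painter has to color b and can then color no vertex of A in that round; the
    last b takes the rest of A.  The resulting position is the same as after
    the original move, but each round marks a single vertex at its last mark,
    so it costs as much excess as it marks vertices of A ([timely_split]).
    Hence the total excess of the moves is at most the number of vertices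
    marked at least once, up to one unit which the first move saves, having no
    b, and which the final edge costs: n altogether.

    Exact length: once Lister has won, the remaining marks can be distributed
    over any number of rounds between max f and sum f ([legal_play_exists]).
    Moves that make no progress (independent sets with A empty, or a single
    vertex) are skipped, so every round before the final edge marks a vertex
    for the first time and the first one marks two; therefore enough rounds are
    left at the end.  Both requirements are the inequalities in [roomy]. *)

Set Implicit Arguments.
Unset Strict Implicit.
Unset Printing Implicit Defensive.

(** * Plays, round by round *)

Section Game.

Context {T : finType} (e : rel T).

Implicit Types (f g : T -> nat) (U V W X A B : {set T}) (S : strategy T).
Implicit Types (Vs : seq {set T}) (t : nat).

Definition mark V f : T -> nat := fun v => f v - (v \in V).

(** The strategy that Painter follows from the second round on, V being the
    first marked set. *)
Definition residual S V : strategy T := fun Vs => S (V :: Vs).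

(** Painter wins when only the vertices of U have to be colored; in this form
    the play can be unfolded one round at a time. *)
Fixpoint wins_from U S Vs : bool :=
  if Vs is V :: Vs' then
    [&& S [:: V] \subset V, independent e (S [:: V])
      & wins_from (U :\: S [:: V]) (residual S V) Vs']
  else U == set0.

Lemma independentP X :
  reflect (forall u v, u \in X -> v \in X -> ~~ e u v) (independent e X).
Proof.
apply: (iffP forall_inP) => [H u v uX vX | H u uX]; first exact: (forall_inP (H u uX)).
by apply/forall_inP => v vX; exact: H.
Qed.

Lemma independent_set0 : independent e set0.
Proof. by apply/independentP => u v; rewrite inE. Qed.

Lemma independentS X (Y : {set T}) : X \subset Y -> independent e Y -> independent e X.
Proof.
move=> /subsetP sub /independentP ind; apply/independentP => u v /sub uY /sub.
exact: ind.
Qed.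

Lemma wins_from_spec U S Vs : wins_from U S Vs <->
  (forall i, i < size Vs ->
     reply S Vs i \subset nth set0 Vs i /\ independent e (reply S Vs i)) /\
  (forall v, v \in U -> exists2 i, i < size Vs & v \in reply S Vs i).
Proof.
elim: Vs U S => [|V Vs IH] U S.
  split=> [/eqP-> | [_ H]]; first by split=> // v; rewrite inE.
  by apply/eqP/setP => v; rewrite inE; apply/negP => /H[].
rewrite /=; split=> [/and3P[sub ind /IH[legal cover]] | [legal cover]].
  split=> [[|i] lti | v vU]; first 1 last.
  - exact: legal i lti.
  - case: (boolP (v \in S [:: V])) => [vS | vS]; first by exists 0; rewrite // /reply /= take0.
    have [|i lti vi] := cover v; first by rewrite inE vS.
    by exists i.+1.
  - by rewrite /reply /= take0.
have:= legal 0 isT; rewrite /reply /= take0 => -[-> ->] /=.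
apply/IH; split=> [i lti | v]; first exact: legal i.+1 lti.
rewrite inE => /andP[vS vU]; have [[|i] lti vi] := cover v vU.
  by move: vi vS; rewrite /reply /= take0 => ->.
by exists i.
Qed.

Lemma wins_playE S Vs : wins_play e S Vs <-> wins_from setT S Vs.
Proof.
rewrite wins_from_spec; split=> -[legal cover]; split=> // v; exact: cover.
Qed.

(** The residual of a [positional] strategy agrees with the positional strategy
    at the next position on nonempty histories, but not on the empty one. *)
Lemma eq_wins_from U S S' Vs :
    (forall V Ws, S (V :: Ws) = S' (V :: Ws)) ->
  wins_from U S Vs = wins_from U S' Vs.
Proof.
elim: Vs U S S' => //= V Vs IH U S S' eqS.
by rewrite eqS (IH _ _ (residual S' V)) // => W Ws; apply: eqS.
Qed.

Lemma wins_from_sub U U' S Vs :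
  U' \subset U -> wins_from U S Vs -> wins_from U' S Vs.
Proof.
move=> sub /wins_from_spec[legal cover]; apply/wins_from_spec; split=> // v vU.
exact/cover/(subsetP sub).
Qed.

Lemma legal_play_nil f : legal_play f [::] <-> forall v, f v = 0.
Proof. by split=> [[_ H] v | H]; [rewrite -H | split]. Qed.

Lemma legal_play_cons f V Vs : legal_play f (V :: Vs) <->
  [/\ V != set0, forall v, v \in V -> 0 < f v & legal_play (mark V f) Vs].
Proof.
split=> [[/= /andP[V0 Vs0] cnt] | [V0 pos [Vs0 cnt]]].
  split=> // [v vV | ]; first by rewrite -cnt vV.
  by split=> // v; rewrite /mark -cnt addKn.
split=> [|v /=]; first by rewrite /= V0.
by rewrite cnt /mark subnKC //; case: (boolP (v \in V)) => // /pos.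
Qed.

Lemma sum_mark V f : (forall v, v \in V -> 0 < f v) ->
  \sum_v mark V f v + #|V| = \sum_v f v.
Proof.
move=> pos; rewrite -sum1_card (big_mkcond (mem V)) -big_split /=.
apply: eq_bigr => v _; rewrite /mark; case: ifP => [/pos|]; lia.
Qed.

Lemma wins_from_pos f U S Vs v : legal_play f Vs -> wins_from U S Vs ->
  v \in U -> 0 < f v.
Proof.
move=> [_ cnt] /wins_from_spec[legal cover] /cover[i lti vi].
rewrite -cnt -has_count; apply/(has_nthP set0); exists i => //.
by have [/subsetP-> ] := legal i lti.
Qed.

(** * Painter: positional strategies and determinacy *)

(** The strategy that chooses each color class from the current position and
    the marked set alone, updating the position along the history. *)
Fixpoint positional (move : {set T} -> (T -> nat) -> {set T} -> {set T}) U f Vs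
    : {set T} :=
  if Vs is V :: Vs' then
    let X := move U f V in
    if Vs' is [::] then X else positional move (U :\: X) (mark V f) Vs'
  else set0.

Lemma positional_wins (move : {set T} -> (T -> nat) -> {set T} -> {set T})
    (inv : {set T} -> (T -> nat) -> seq {set T} -> Prop) :
    (forall U f, legal_play f [::] -> inv U f [::] -> U = set0) ->
    (forall U f V Vs, legal_play f (V :: Vs) -> inv U f (V :: Vs) ->
      let X := move U f V in
      [/\ X \subset V, independent e X & inv (U :\: X) (mark V f) Vs]) ->
  forall U f Vs, legal_play f Vs -> inv U f Vs ->
    wins_from U (positional move U f) Vs.
Proof.
move=> inv0 invS U f Vs; elim: Vs U f => [|V Vs IH] U f leg I; first by rewrite /= (inv0 _ _ leg I).
have [/= -> -> I'] := invS _ _ _ _ leg I.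
have /legal_play_cons[_ _ leg'] := leg.
rewrite (@eq_wins_from _ _ (positional move (U :\: move U f V) (mark V f))) //.
exact: IH.
Qed.

(** Lister wins the unrestricted game.  Marks on colored vertices have no
    effect, so Lister is made to mark uncolored vertices only. *)
Inductive lister_wins U f : Prop :=
| lister_wins_exhausted v of v \in U & f v = 0
| lister_wins_move V of V \subset U & V != set0 &
    (forall X, X \subset V -> independent e X ->
       lister_wins (U :\: X) (mark V f)).

Lemma eq_lister_wins U f g :
  {in U, f =1 g} -> lister_wins U f -> lister_wins U g.
Proof.
move=> + W; elim: W g => {U f} [U f v vU v0 | U f V sub V0 _ IH] g eqfg.
  by apply: (lister_wins_exhausted vU); rewrite -eqfg.
apply: (lister_wins_move sub V0) => X subX indX; apply: IH => // v.
by rewrite inE /mark => /andP[_ /eqfg->].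
Qed.

(** At a position not won by Lister, every marked set has an answer leading to
    another such position; a positional strategy that chooses such answers
    wins, because when all marks have been spent an uncolored vertex would be
    exhausted. *)
Lemma determinacy f : ~ lister_wins setT f -> paintable e f.
Proof.
move=> nL.
pose safe U f V X := [&& X \subset V :&: U, independent e X
  & ~~ `[< lister_wins (U :\: X) (mark V f) >]].
pose move U f V := odflt set0 [pick X | safe U f V X].
have safe_move U g V : ~ lister_wins U g ->  safe U g V (move U g V).
  rewrite /move; case: pickP => //= none []; rewrite -/(lister_wins U g).
  (* [lister_wins_move] only allows nonempty subsets of U, so a marked set
     without uncolored vertices is treated separately. *)
  have [VU0|VU0] := eqVneq (V :&: U) set0.
    have /= := none set0; rewrite /safe sub0set independent_set0 /= setD0.
    move/negbFE/asboolP; apply: eq_lister_wins => v vU; rewrite /mark.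
    by have:= in_set0 v; rewrite -VU0 inE vU andbT => ->; rewrite subn0.
  apply: (@lister_wins_move _ _ (V :&: U)) => //; first exact: subsetIr.
  move=> X subX indX; have:= none X; rewrite /safe subX indX /=.
  move/negbFE/asboolP; apply: eq_lister_wins => v.
  by rewrite /mark !inE => /andP[_ ->]; rewrite andbT.
exists (positional move setT f) => Vs leg; apply/wins_playE.
apply: (@positional_wins move (fun U g _ => ~ lister_wins U g)) => //.
  move=> U g /legal_play_nil g0 nU; apply/setP => v; rewrite inE.
  by apply/negP => vU; apply: nU; apply: (lister_wins_exhausted vU).
move=> U g V Vs' leg' /safe_move - /(_ V)/and3P[subX indX /asboolP].
by split=> //; apply: subset_trans subX (subsetIl _ _).
Qed.

(** * Painter wins when nearly all marked sets are singletons *)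

Lemma legal_play_size f Vs : legal_play f Vs -> size Vs <= \sum_v f v.
Proof.
elim: Vs f => //= V Vs IH f /legal_play_cons[V0 pos /IH].
have := sum_mark pos; have : 0 < #|V| by rewrite card_gt0.
lia.
Qed.

Definition endangered U f := [set v in U | f v == 1].

Definition greedy U f V : {set T} :=
  if [pick v in V :&: endangered U f] is Some v then [set v]
  else if [pick v in V :&: U] is Some v then [set v] else set0.

Hypothesis e_irr : irreflexive e.

Lemma independent_set1 v : independent e [set v].
Proof. by apply/independentP => u w /set1P-> /set1P->; rewrite e_irr. Qed.

(** The last hypothesis says that the number of endangered vertices plus the
    excess of the rest of the play is at most 2.  This is invariant: a marked
    set V consumes |V| - 1 units of excess, and endangers at most |V| - 1 new
    vertices as one vertex is colored.  Painter could lose a vertex only when V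
    contains two endangered ones, but then the excess is positive and the
    invariant is violated. *)
Lemma greedy_wins U f Vs : legal_play f Vs ->
    (forall v, v \in U -> 0 < f v) ->
    #|endangered U f| + \sum_v f v <= size Vs + 2 ->
  wins_from U (positional greedy U f) Vs.
Proof.
move=> leg pos small.
pose inv U f Vs := (forall v, v \in U -> 0 < f v) /\
  #|endangered U f| + \sum_v f v <= size Vs + 2.
apply: (@positional_wins _ inv) => // {U f Vs leg pos small}.
  move=> U f /legal_play_nil f0 [pos _]; apply/setP => v; rewrite inE.
  by apply/negP => /pos; rewrite f0.
move=> U f V Vs /legal_play_cons[V0 fV leg] [pos small].
have sumV := sum_mark fV; have := legal_play_size leg.
have V_gt0 : 0 < #|V| by rewrite card_gt0.
move: small; rewrite /inv /greedy /=.
case: pickP => [v | none1].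
  rewrite inE => /andP[vV vE] small size_le.
  have vU : v \in U by move: vE; rewrite inE => /andP[].
  rewrite sub1set vV independent_set1; split=> //.
  have cardV := cardsD1 v V; rewrite vV in cardV.
  have cardE := cardsD1 v (endangered U f); rewrite vE in cardE.
  split=> [w|].
    rewrite !inE => /andP[wv wU]; rewrite /mark.
    have f_gt0 := pos w wU; case: (boolP (w \in V)) => [wV|]; last lia.
    have [fw1|] := eqVneq (f w) 1; last lia.
    have : 0 < #|endangered U f :\ v|.
      by apply/card_gt0P; exists w; rewrite !inE wv wU fw1.
    have : 0 < #|V :\ v| by apply/card_gt0P; exists w; rewrite !inE wv wV.
    lia.
  have : #|endangered (U :\ v) (mark V f)|
      <= #|(endangered U f :\ v) :|: (V :\ v)|.
    apply/subset_leq_card/subsetP => w; rewrite !inE /mark.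
    by case: (w \in V) => /andP[/andP[-> ->]]; rewrite ?subn0 ?orbT //= => ->.
  have := (leq_card_setU (endangered U f :\ v) (V :\ v)).1.
  lia.
have noE w : w \in V -> w \in U -> 1 < f w.
  move=> wV wU; have := none1 w; rewrite !inE wV wU /=; have := pos w wU; lia.
move=> small size_le; split; try by case: pickP => [v|_];
  rewrite ?sub0set ?independent_set0 ?independent_set1 // inE sub1set => /andP[].
split=> [w | ].
  rewrite !inE => /andP[_ wU]; rewrite /mark; have := pos w wU.
  by case: (boolP (w \in V)) => [/noE/(_ wU)|_]; lia.
case: pickP => [v | none2]; last first.
  have : #|endangered (U :\: set0) (mark V f)| <= #|endangered U f|.
    apply/subset_leq_card/subsetP => w; rewrite !inE /mark.
    have := none2 w; rewrite inE; case: (w \in V) => //= [->|] //.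
    by rewrite subn0.
  lia.
rewrite inE => /andP[vV vU].
have cardV := cardsD1 v V; rewrite vV in cardV.
have : #|endangered (U :\ v) (mark V f)| <= #|endangered U f :|: (V :\ v)|.
  apply/subset_leq_card/subsetP => w; rewrite !inE /mark.
  by case: (w \in V) => /andP[/andP[-> ->]]; rewrite ?subn0 ?orbT //= => ->.
have := (leq_card_setU (endangered U f) (V :\ v)).1.
lia.
Qed.

Lemma paintable_in_many_rounds t :
  2 * #|T| <= t + 2 -> paintable_in e (fun=> 2) t.
Proof.
move=> big; exists (positional greedy setT (fun=> 2)) => Vs leg size_t.
apply/wins_playE/greedy_wins => //; rewrite sum_nat_const size_t.
suff -> : endangered setT (fun=> 2) = set0 by rewrite cards0 mulnC.
by apply/setP => v; rewrite !inE.
Qed.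

(** * Lister: the basic moves in the game of fixed length *)

(** Lister wins with exactly t rounds left, the vertices of U being uncolored.
    Since Painter's strategy is fixed first, Lister's answer is a whole play. *)
Definition beaten U f t := forall S,
  exists Vs, [/\ legal_play f Vs, size Vs = t & ~~ wins_from U S Vs].

Lemma beaten_sub U U' f t : U' \subset U -> beaten U' f t -> beaten U f t.
Proof.
move=> sub H S; have [Vs [leg size_t lose]] := H S.
by exists Vs; split=> //; apply: contra lose; apply: wins_from_sub.
Qed.

(** If Painter's first answer is illegal the play is lost by Painter already,
    but it still has to be completed to a legal play of the right length; the
    hypothesis at X = set0 provides a completion. *)
Lemma beaten_step U f t V : V != set0 -> (forall v, v \in V -> 0 < f v) ->
    (forall X, X \subset V -> independent e X -> beaten (U :\: X) (mark V f) t) ->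
  beaten U f t.+1.
Proof.
move=> V0 pos H S.
suff [Vs [leg size_t lose]] : exists Vs, [/\ legal_play (mark V f) Vs,
    size Vs = t & ~~ wins_from U S (V :: Vs)].
  by exists (V :: Vs); split=> //=; [exact/legal_play_cons | rewrite size_t].
rewrite /=; case: (boolP (S [:: V] \subset V)) => subV; last first.
  by have [Vs [leg size_t _]] := H _ (sub0set V) independent_set0 S; exists Vs.
case: (boolP (independent e (S [:: V]))) => ind; last first.
  by have [Vs [leg size_t _]] := H _ (sub0set V) independent_set0 S; exists Vs.
exact: H.
Qed.

Lemma legal_play_exists f t : (forall v, f v <= t) -> t <= \sum_v f v ->
  exists Vs, legal_play f Vs /\ size Vs = t.
Proof.
elim: t f => [|t IH] f max_f sum_f.
  by exists [::]; split=> //; apply/legal_play_nil => v; apply/eqP; rewrite -leqn0.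
suff [V [V0 pos max_V sum_V]] : exists V, [/\ V != set0,
    forall v, v \in V -> 0 < f v, forall v, mark V f v <= t
    & t + #|V| <= \sum_v f v].
  have low : t <= \sum_v mark V f v by have := sum_mark pos; lia.
  have [Vs [leg size_t]] := IH _ max_V low.
  by exists (V :: Vs); split; [exact/legal_play_cons | rewrite /= size_t].
(* The vertices that must be marked in each remaining round; if there are
   none, one round is spent on a single vertex. *)
pose V := [set v | f v == t.+1].
have [V0|VN0] := eqVneq V set0.
  have [v fv] : exists v, 0 < f v.
    apply/existsP; apply: contraTT sum_f => /existsPn none.
    by rewrite big1 // => v _; have := none v; case: (f v).
  exists [set v]; split=> [|w /set1P->//|w|]; last by rewrite cards1 addn1.
    by apply/set0Pn; exists v; rewrite set11.
  have := in_set0 w; rewrite -V0 inE /mark; have := max_f w; lia.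
exists V; split=> // [v|v|]; rewrite /mark ?inE; first by move=> /eqP->.
  by have := max_f v; case: eqP; lia.
have : #|V| * t.+1 <= \sum_v f v.
  rewrite -sum_nat_const (big_mkcond (mem V)) /=.
  by apply: leq_sum => v _; rewrite inE; case: eqP => // ->.
have : 0 < #|V| by rewrite card_gt0.
nia.
Qed.

Lemma beaten_exhausted U f t v : v \in U -> f v = 0 ->
  (forall w, f w <= t) -> t <= \sum_w f w -> beaten U f t.
Proof.
move=> vU fv0 max_f sum_f S; have [Vs [leg size_t]] := legal_play_exists max_f sum_f.
exists Vs; split=> //; apply/negP => win.
by have := wins_from_pos leg win vU; rewrite fv0.
Qed.

Definition fresh U f := #|[set v in U | f v == 2]|.

Definition started U f : bool := [exists v in U, f v < 2].

(** The two inequalities that keep the length of the game feasible.  The first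
    one says that the excess available, sum f - t, covers one unit for each
    uncolored vertex with two marks left and, once some uncolored vertex is at
    its last mark, one unit for the winning edge.  The second one leaves as
    many rounds as there are never marked vertices, and one more once the game
    has started, so that t >= max f when Lister has won.  Both hold with
    equality at the initial position with t = n. *)
Definition roomy U f t := [/\ forall v, f v <= 2,
  t + fresh U f + started U f <= \sum_v f v
  & fresh setT f + started U f <= t].

(** Lister wins in any feasible number of rounds.  Outside U the counts may
    differ from f: dropping vertices from U, as [timely_sub] does, then leaves
    their marks available for filling up the rounds. *)
Definition timely U f := forall g t, {in U, g =1 f} -> roomy U g t -> beaten U g t.

(** A vertex with two marks left is itself counted in [fresh setT f], so that
    two rounds are left. *)
Lemma roomy_max U f t : started U f -> roomy U f t -> forall w, f w <= t.
Proof.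
move=> st [max_f _]; rewrite st => low w.
have [fw2|] := eqVneq (f w) 2; last by have := max_f w; lia.
have : 0 < fresh setT f by apply/card_gt0P; exists w; rewrite !inE fw2.
lia.
Qed.

Lemma timely_exhausted U f v : v \in U -> f v = 0 -> timely U f.
Proof.
move=> vU fv0 g t eqg room.
have gv0 : g v = 0 by rewrite eqg.
have st : started U g by apply/existsP; exists v; rewrite vU gv0.
apply: (beaten_exhausted vU gv0); first exact: roomy_max room.
by case: room; lia.
Qed.

(** The two ends are marked for the last time together, and Painter can color
    only one of them. *)
Lemma timely_edge U f u v : u \in U -> v \in U -> e u v -> f u = 1 -> f v = 1 ->
  timely U f.
Proof.
move=> uU vU euv fu1 fv1 g t eqg room.
have [gu1 gv1] : g u = 1 /\ g v = 1 by rewrite !eqg.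
have st : started U g by apply/existsP; exists v; rewrite vU gv1.
have max_g := roomy_max st room.
have {room st} : t < \sum_v g v by case: room; rewrite st; lia.
have uv : u != v by apply: contraTneq euv => ->; rewrite e_irr.
case: t max_g => [/(_ u)|t max_g sum_g]; first by rewrite gu1.
(* Vertices that need a mark in every remaining round are marked along with
   the edge. *)
pose M := [set w | g w == t.+1].
pose V := u |: (v |: M).
have pos w : w \in V -> 0 < g w.
  by rewrite !inE => /or3P[]/eqP->; rewrite ?gu1 ?gv1.
have max_V w : mark V g w <= t.
  have := max_g w; rewrite /mark /V.
  case: (boolP (w \in _)); last by rewrite !inE !negb_or => /and3P[_ _]; lia.
  by lia.
have sum_V : t <= \sum_w mark V g w.
  have [M0|] := eqVneq M set0.
    have := sum_mark pos; have : #|V| <= 2.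
      by rewrite /V M0 setU0 cardsU1 cards1 addn1 ltnS; case: (_ \notin _).
    lia.
  case/set0Pn => w wM; rewrite (bigD1 w) //=; apply: leq_trans (leq_addr _ _).
  by move: wM; rewrite /mark !inE => /eqP->; rewrite eqxx !orbT subn1.
apply: (@beaten_step _ _ _ V) => // [|X subX indX].
  by apply/set0Pn; exists u; rewrite setU11.
have [w [wV wX gw1]] : exists w, [/\ w \in U, w \in V :\: X & g w = 1].
  case: (boolP (u \in X)) => uX; last by exists u; rewrite !inE uX eqxx.
  exists v; rewrite !inE eqxx orbT vU; split=> //=; rewrite andbT.
  by apply/negP => vX; have := independentP _ indX u v uX vX; rewrite euv.
apply: (@beaten_exhausted _ _ _ w) => //; move: wX; rewrite !inE => /andP[wX wV'].
  by rewrite wX.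
by rewrite /mark gw1 !inE wV'.
Qed.

(** Lister may disregard some uncolored vertices: this is how moves that make
    no progress are skipped without spending a round. *)
Lemma timely_sub U U' f f' : U' \subset U -> {in U', f =1 f'} ->
  timely U' f' -> timely U f.
Proof.
move=> sub eqf timelyU' g t eqg [max2 sum_g low]; apply: (beaten_sub sub).
have le_fresh : fresh U' g <= fresh U g.
  apply/subset_leq_card/subsetP => v; rewrite !inE => /andP[/(subsetP sub)->].
  by [].
have le_started : started U' g <= started U g.
  case: (boolP (started U' g)) => // /existsP[v /andP[/(subsetP sub) vU gv]].
  by rewrite lt0b; apply/existsP; exists v; rewrite vU.
apply: timelyU' => [v vU'|]; first by rewrite eqg ?eqf // (subsetP sub).
by split=> //; lia.
Qed.

Lemma timely_bounded U f : ((forall v, v \in U -> f v <= 2) -> timely U f) -> timely U f.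
Proof.
move=> H g t eqg [max2 sum_g low]; apply: H => // v vU.
by rewrite -eqg.
Qed.

Lemma fresh_mark U W V f : (forall v, f v <= 2) -> W \subset U -> V \subset U ->
  fresh W (mark V f) + #|[set v in V | f v == 2]| <= fresh U f.
Proof.
move=> max2 /subsetP subW /subsetP subV.
rewrite -[fresh U f](cardsID [set v in V | f v == 2]) addnC leq_add //; apply/subset_leq_card.
  by apply/subsetP => v; rewrite !inE => /andP[vV ->]; rewrite subV ?vV.
apply/subsetP => v; rewrite !inE /mark => /andP[/subW ->].
by have := max2 v; case: (v \in V) => /=; lia.
Qed.

(** With a = |{v in V | f v = 2}|, marking V lowers both sides of the first
    inequality of [roomy] enough because it costs |V| - 1 units of excess, that
    is at most a if V has a vertex at its last mark, and a - 1 if not; in the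
    latter case the gain pays for the game having started.  The second
    inequality survives because a >= 1, and a >= 2 in the latter case. *)
Lemma timely_move U f V : V \subset U -> 1 < #|V| ->
    (forall v, v \in V -> 0 < f v) -> #|[set v in V | f v == 1]| <= 1 ->
    (forall X, X \subset V -> independent e X -> timely (U :\: X) (mark V f)) ->
  timely U f.
Proof.
move=> subV V_gt1 posf card1 H g t eqg [max2 sum_g low].
have posg v : v \in V -> 0 < g v by move=> vV; rewrite eqg ?posf // (subsetP subV).
pose A := [set v in V | g v == 2]; pose B := [set v in V | g v == 1].
have cardV : #|V| = #|A| + #|B|.
  rewrite -(cardsID A); congr (_ + _); apply: eq_card => v.
    by rewrite !inE; case: (v \in V).
  rewrite !inE; case: (boolP (v \in V)) => //= /posg.
  by have := max2 v; lia.
have B_le1 : #|B| <= started U g.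
  have [->|/set0Pn[v]] := eqVneq B set0; first by rewrite cards0.
  rewrite inE => /andP[vV /eqP gv1].
  have -> : started U g by apply/existsP; exists v; rewrite (subsetP subV) // gv1.
  apply: leq_trans card1; apply/subset_leq_card/subsetP => w; rewrite !inE.
  by move=> /andP[wV]; rewrite wV eqg // (subsetP subV).
have D_ge : #|A| <= fresh setT g.
  by have := fresh_mark max2 (sub0set setT) (subsetT V); rewrite -/A; lia.
have t_gt0 : 0 < t by lia.
case: t t_gt0 sum_g low => // t _ sum_g low.
apply: (@beaten_step _ _ _ V) => // [|X subX indX].
  by rewrite -card_gt0; lia.
have := sum_mark posg.
have := fresh_mark max2 (subsetDl U X) subV.
have := fresh_mark max2 (subsetT setT) (subsetT V).
rewrite -/A => freshT freshU sumV.
have := leq_b1 (started (U :\: X) (mark V g)) => st.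
apply: (H X) => // [v | ].
  by rewrite inE /mark => /andP[_ vU]; rewrite eqg.
split; [|lia|lia].
by move=> v; apply: leq_trans (max2 v); apply: leq_subr.
Qed.

(** * Splitting the moves of Lister, and the lower bound *)

Hypothesis e_sym : symmetric e.

(** The move A :|: B is replaced by one move for each vertex b of B, as
    explained at the top.  By induction on |B|: Lister marks b with its
    neighbors in A, which forces Painter to color b and nothing else; the other
    vertices of A are not adjacent to b, so any answer X to the rest of the
    move extends to the answer b |: X to A :|: B. *)
Lemma timely_split U f A B : A \subset U -> B \subset U ->
    (forall v, v \in A -> f v = 2) -> (forall v, v \in B -> f v = 1) ->
    independent e B -> (A != set0 -> B != set0) ->
    (forall X, X \subset A :|: B -> independent e X ->
       timely (U :\: X) (mark (A :|: B) f)) ->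
  timely U f.
Proof.
elim: {B}_.+1 {-2}B (ltnSn #|B|) U f A => // n IH B cardB U f A.
move=> subA subB fA fB indB AB timelyAB.
have fAB v : v \in A -> v \in B -> False by move=> /fA fv2 /fB; rewrite fv2.
(* Nothing else is to be marked: Painter might as well have colored B. *)
have [A0|A0] := eqVneq A set0.
  rewrite {}A0 set0U in timelyAB.
  apply: timely_sub (timelyAB B (subxx _) indB); first exact: subsetDl.
  by move=> v; rewrite inE /mark => /andP[/negPf->]; rewrite subn0.
have [b bB] := set0Pn _ (AB A0).
have bA : b \notin A by apply/negP => /fAB/(_ bB).
have bU := subsetP subB b bB.
(* The last vertex of B is marked with all that is left of A. *)
have [Bb0|Bb0] := eqVneq (B :\ b) set0.
  have defB : B = [set b].
    by apply/eqP; rewrite eqEsubset sub1set bB andbT -setD_eq0 Bb0.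
  rewrite {}defB in timelyAB; apply: (timely_move _ _ _ _ timelyAB).
  - by rewrite subUset subA sub1set.
  - by rewrite setUC cardsU1 bA ltnS card_gt0.
  - by move=> v; rewrite !inE => /orP[/fA->|/eqP->] //; rewrite fB.
  - rewrite -[leqRHS](cards1 b); apply/subset_leq_card/subsetP => v; rewrite !inE.
    by case/andP => /orP[/fA->|].
pose A1 := [set v in A | e b v].
have A1A : A1 \subset A by apply/subsetP => v; rewrite inE => /andP[].
have timelyb : timely (U :\ b) (mark (b |: A1) f).
  apply: (IH (B :\ b) _ _ _ (A :\: A1)) => //.
  - by have := cardsD1 b B; rewrite bB; lia.
  - apply/subsetP => v; rewrite !inE => /andP[_ vA]; rewrite (subsetP subA) //.
    by rewrite andbT; apply: contraNneq bA => <-.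
  - by apply: setSD.
  - move=> v; rewrite !inE /mark => /andP[vA1 vA]; rewrite !inE vA.
    rewrite vA /= in vA1; rewrite (negPf vA1) orbF fA //.
    by case: eqP => // vb; rewrite -vb vA in bA.
  - move=> v; rewrite !inE /mark => /andP[vb vB]; rewrite !inE (negPf vb) fB //=.
    by case: (boolP (v \in A)) => // /fAB/(_ vB).
  - by apply: independentS indB; apply: subsetDl.
  move=> X /subsetP subX indX.
  have indbX : independent e (b |: X).
    have eb v : v \in X -> ~~ e b v.
      move/subX; rewrite !inE => /orP[/andP[+ vA]|/andP[_ vB]].
        by rewrite vA.
      exact: (independentP _ indB).
    apply/independentP => u v; rewrite !inE => /orP[/eqP->|uX] /orP[/eqP->|vX].
    - by rewrite e_irr.
    - exact: eb.
    - by rewrite e_sym eb.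
    - exact: (independentP _ indX).
  have subbX : b |: X \subset A :|: B.
    apply/subsetP => v; rewrite in_setU1 => /orP[/eqP->|/subX].
      by rewrite inE bB orbT.
    by rewrite !inE => /orP[]/andP[_ ->]; rewrite ?orbT.
  apply: timely_sub (timelyAB _ subbX indbX); first by rewrite setDDl.
  move=> v; rewrite !inE negb_or /mark => /andP[/andP[vb vX] vU].
  rewrite !inE (negPf vb) /=.
  case: (boolP (v \in A)) => vA /=; last by rewrite subn0.
  case: (boolP (v \in B)) => [/(fAB _ vA)//|_].
  by case: (e b v); rewrite ?subn0.
(* If b has no neighbor left in A it is skipped. *)
have [A10|A10] := eqVneq A1 set0.
  apply: timely_sub timelyb; first exact: subsetDl.
  by move=> v; rewrite /mark A10 !inE => /andP[/negPf->]; rewrite subn0.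
apply: (@timely_move _ _ (b |: A1)).
- by rewrite subUset sub1set bU (subset_trans A1A).
- by rewrite cardsU1 !inE (negPf bA) /= ltnS card_gt0.
- by move=> v; rewrite !inE => /orP[/eqP->|/andP[/fA->]] //; rewrite fB.
- rewrite -[leqRHS](cards1 b); apply/subset_leq_card/subsetP => v; rewrite !inE.
  by case/andP => /orP[|/andP[/fA->]].
move=> X /subsetP subX indX.
case: (boolP (b \in X)) => bX; last first.
  apply: (@timely_exhausted _ _ b); first by rewrite inE bX.
  by rewrite /mark setU11 fB.
suff -> : X = [set b] by [].
apply/setP => v; rewrite inE; apply/idP/eqP => [vX|-> //].
move: (subX v vX); rewrite !inE => /orP[/eqP//|/andP[_ ebv]].
by have := independentP _ indX b v bX vX; rewrite ebv.
Qed.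

Lemma lister_wins_timely U f : lister_wins U f -> timely U f.
Proof.
elim=> {U f} [U f v vU fv0 | U f V subV V0 _ IH]; first exact: timely_exhausted fv0.
apply: timely_bounded => max2.
have [/exists_inP[v vU /eqP fv0]|/exists_inPn pos] := boolP [exists v in U, f v == 0].
  exact: timely_exhausted fv0.
pose A := [set v in V | f v == 2]; pose B := [set v in V | f v == 1].
have defV : V = A :|: B.
  apply/setP => v; rewrite !inE -andb_orr.
  case: (boolP (v \in V)) => //= /(subsetP subV) vU.
  have := max2 v vU; have := pos v vU; lia.
have [indB|] := boolP (independent e B); last first.
  case/forall_inPn => u uB /forall_inPn[v vB /negPn euv].
  move: uB vB; rewrite !inE => /andP[uV /eqP fu] /andP[vV /eqP fv].
  by apply: (timely_edge _ _ euv fu fv); apply: (subsetP subV).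
have [AB|] := boolP ((A != set0) ==> (B != set0)).
  apply: (@timely_split _ _ A B) => //; rewrite -?defV //.
  - by apply: subset_trans subV; rewrite defV subsetUl.
  - by apply: subset_trans subV; rewrite defV subsetUr.
  - by move=> v; rewrite inE => /andP[_ /eqP].
  - by move=> v; rewrite inE => /andP[_ /eqP].
  - exact/implyP.
rewrite negb_imply negbK => /andP[_ /eqP B0].
(* From here on all vertices of V have two marks left. *)
have [V_gt1|V_le1] := ltnP 1 #|V|.
  apply: timely_move IH; rewrite // -?/B ?B0 ?cards0 // => v /(subsetP subV)/pos.
  by rewrite lt0n.
have /cards1P[v defv] : #|V| == 1 by rewrite eqn_leq V_le1 card_gt0.
have indV : independent e V by rewrite defv independent_set1.
apply: timely_sub (IH V (subxx _) indV); first exact: subsetDl.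
by move=> w; rewrite inE /mark => /andP[/negPf->]; rewrite subn0.
Qed.

Lemma not_paintable_in_order : ~ paintable e (fun=> 2) ->
  ~ paintable_in e (fun=> 2) #|T|.
Proof.
move=> nP [S winS]; apply: nP; apply: determinacy => /lister_wins_timely timelyT.
have [|Vs [leg size_t /negP[]]] := timelyT (fun=> 2) #|T| (fun _ _ => erefl) _ S.
  have not_started : started setT (fun=> 2) = false.
    by apply/existsP => -[v]; rewrite ltnn andbF.
  have all_fresh : fresh setT (fun=> 2) = #|T|.
    by rewrite -cardsT; apply: eq_card => v; rewrite !inE.
  have sumT : \sum_(v : T) 2 = #|T| * 2 by rewrite sum_nat_const.
  by split=> //; rewrite not_started all_fresh ?sumT; lia.
exact/wins_playE/winS.
Qed.

End Game.

(** * The value of M *)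

Lemma max_exists (P : nat -> Prop) (b k : nat) :
  (forall t, P t -> t <= b) -> P k -> exists2 m, P m & forall t, P t -> t <= m.
Proof.
move=> bound Pk; have exP : exists t, `[< P t >] by exists k; apply/asboolP.
have boundP t : `[< P t >] -> t <= b by move/asboolP; apply: bound.
have [m /asboolP Pm maxm] := ex_maxnP exP boundP.
by exists m => // t Pt; apply: maxm; apply/asboolP.
Qed.

Theorem corollary25 (T : finType) (e : rel T)
    (e_sym : symmetric e) (e_irr : irreflexive e)
    (not_paintable : ~ paintable e (fun _ => 2)) :
  exists m : nat, is_M e m /\ #|T| <= m /\ m + 3 <= 2 * #|T|.
Proof.
have few t : ~ paintable_in e (fun=> 2) t -> t + 3 <= 2 * #|T|.
  move=> nP; rewrite leqNgt; apply/negP => many.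
  by apply: nP; apply: (paintable_in_many_rounds e_irr); lia.
have losing := not_paintable_in_order e_irr e_sym not_paintable.
have bound t : ~ paintable_in e (fun=> 2) t -> t <= 2 * #|T| by move/few; lia.
have [m losing_m max_m] := max_exists bound losing.
by exists m; split=> //; split; [apply: max_m | apply: few].
Qed.
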